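(* Let $A$ be a (not necessarily symmetric) square nonnegative matrix of size $n\times n$, with $|A|_{\infty}\leq 1$, and with zero diagonal. Then $$\left\|A+\tfrac{1}{2}I_{n}\right\|_{*}+\left\|J_{n}-A-\tfrac{1}{2}I_{n}\right\|_{*}\leq n+(n-1)\sqrt{n}.$$ Equality holds if and only if $A$ is a $(0,1)$-matrix, with all row sums and all column sums equal to $(n-1)/2$, and such that $\sigma_{i}\left(A+\tfrac{1}{2}I_{n}\right)=\sqrt{n}/2$ for $i=2,\ldots,n$.
   Context: Matrices are real, and nonnegative means entrywise nonnegative. $I_n$ is the $n\times n$ identity matrix and $J_n$ is the $n\times n$ all-ones matrix. $|A|_{\infty}$ is the maximum of the absolute values of the entries of $A$. $\sigma_1(A)\geq\sigma_2(A)\geq\cdots$ denote the singular values of $A$ in nonincreasing order, and the trace norm $\|A\|_{*}$ is the sum of the singular values of $A$. *)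

(* Defs.v *)
From mathcomp Require Import all_boot all_order all_algebra.
From mathcomp Require Import polyrcf.
From mathcomp Require complex.

Set Implicit Arguments.
Unset Strict Implicit.
Unset Printing Implicit Defensive.

Import Order.TTheory GRing.Theory Num.Theory.
Local Open Scope ring_scope.

(* [rootsR] lists the distinct real roots, so non-real eigenvalues are dropped;
   for symmetric M the list is complete, see [char_poly_sym]. *)
Definition eigenvalues (R : rcfType) n (M : 'M[R]_n) : seq R :=
  flatten [seq nseq (mup x (char_poly M)) x | x <- rootsR (char_poly M)].

Definition singular_values (R : rcfType) n (A : 'M[R]_n) : seq R :=
  sort >=%R [seq Num.sqrt x | x <- eigenvalues (A^T *m A)].

(* Indexing starts at 1: [sigma 1 A] is the largest singular value. *)
Definition sigma (R : rcfType) n (i : nat) (A : 'M[R]_n) : R :=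
  (singular_values A)`_i.-1.

Definition trace_norm (R : rcfType) n (A : 'M[R]_n) : R :=
  \sum_(s <- singular_values A) s.

Section SingularValuesTheory.
Import complex.
Variables (R : rcfType) (n : nat).
Implicit Types (A M : 'M[R]_n).

Lemma eigenvalues_perm M s :
  char_poly M = \prod_(x <- s) ('X - x%:P) -> perm_eq (eigenvalues M) s.
Proof.
move=> Ms; have M0 : char_poly M != 0 by rewrite monic_neq0 ?char_poly_monic.
apply/allP => x _ /=; apply/eqP.
have -> : count_mem x s = mup x (char_poly M) by rewrite Ms mu_prod_XsubC.
rewrite /eigenvalues count_flatten -map_comp.
have -> : [seq (count_mem x \o (fun y => nseq (mup y (char_poly M)) y)) i
           | i <- rootsR (char_poly M)]
        = [seq (i == x) * mup x (char_poly M) | i <- rootsR (char_poly M)]%N.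
  apply: eq_map => y /=; rewrite count_nseq /=.
  by case: eqP => [->|].
rewrite sumnE big_map -big_distrl /=.
rewrite (_ : \sum_(_ <- _) _ = count_mem x (rootsR (char_poly M)))%N; last first.
  by rewrite -sum1_count [RHS]big_mkcond; apply: eq_bigr => y _ /=; case: (y == x).
have [xr|xr] := boolP (x \in rootsR (char_poly M)).
  by rewrite (count_uniq_mem _ (uniq_roots _ _ _)) xr mul1n.
rewrite mupNroot ?muln0 //.
by move: xr; rewrite -(roots_on_rootsR M0) in_itv.
Qed.

Lemma char_poly_sym M : M^T = M ->
  char_poly M = \prod_(x <- eigenvalues M) ('X - x%:P).
Proof.
move=> symM; pose f : {rmorphism R -> complex R} := real_complex R.
have [d Md] : exists d : 'rV[R]_n, char_poly M = \prod_i ('X - (d 0 i)%:P).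
  pose Mc := map_mx f M.
  have hM : Mc \is hermsymmx.
    apply/is_hermitianmxP; rewrite expr0 scale1r; apply/matrixP => i j.
    rewrite !mxE -[in LHS]symM mxE.
    by apply/esym/CrealP/complex_realP; exists (M j i).
  have /hermitian_normalmx/orthomx_spectralP := hM.
  have /mxOverP dR := hermitian_spectral_diag_real hM.
  have := spectral_unit Mc.
  move: (spectralmx Mc) (spectral_diag Mc) dR => P D dR Pu McE.
  pose d := map_mx (@complex.Re R) D.
  have DE : diag_mx D = map_mx f (diag_mx d).
    apply/matrixP => i j; rewrite !mxE rmorphMn /=.
    by rewrite (RRe_real (dR _ _)).
  exists d; apply: (@map_poly_inj _ _ f).
  rewrite rmorph_prod /= map_char_poly -/Mc McE.
  transitivity (char_poly (diag_mx D)).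
    rewrite /char_poly /char_poly_mx !map_mxM.
    set Pp := map_mx polyC P; set Qp := map_mx polyC (invmx P).
    have QP : Qp *m Pp = 1%:M by rewrite -map_mxM mulVmx // map_mx1.
    have XE : 'X%:M = Qp *m 'X%:M *m Pp
      by rewrite -mulmxA -scalar_mxC mulmxA QP mul1mx.
    rewrite [in LHS]XE -mulmxBl -mulmxBr !det_mulmx mulrAC -det_mulmx QP.
    by rewrite det1 mul1r.
  rewrite DE char_poly_trig; last by rewrite -DE diag_mx_is_trig.
  apply: eq_bigr => i _.
  by rewrite rmorphB /= map_polyX map_polyC !mxE eqxx.
have Mp : char_poly M = \prod_(x <- [seq d 0 i | i <- enum 'I_n]) ('X - x%:P).
  by rewrite Md big_map big_enum.
by rewrite (perm_big _ (eigenvalues_perm Mp)).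
Qed.

Lemma gram_eigenvalue_ge0 A x : x \in eigenvalues (A^T *m A) -> 0 <= x.
Proof.
set M := A^T *m A => xM.
have : eigenvalue M x.
  rewrite eigenvalue_root_char char_poly_sym ?root_prod_XsubC //.
  by rewrite trmx_mul trmxK.
case/eigenvalueP => v vM v0.
have sqE k (u : 'rV[R]_k) : (u *m u^T) 0 0 = \sum_i u 0 i ^+ 2.
  by rewrite mxE; apply: eq_bigr => i _; rewrite mxE expr2.
have vv_gt0 : 0 < (v *m v^T) 0 0.
  rewrite lt_neqAle sqE sumr_ge0 ?andbT; last by move=> i _; apply: sqr_ge0.
  apply: contra v0 => /eqP/esym v0; apply/eqP/rowP => i; rewrite mxE.
  have /psumr_eq0P/(_ v0)/(_ i isT)/eqP := fun i (_ : true) => sqr_ge0 (v 0 i).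
  by rewrite sqrf_eq0 => /eqP.
rewrite -(pmulr_lge0 _ vv_gt0).
have -> : x * (v *m v^T) 0 0 = ((v *m A^T) *m (v *m A^T)^T) 0 0.
  have <- : (v *m M *m v^T) 0 0 = x * (v *m v^T) 0 0.
    by rewrite vM -scalemxAl mxE.
  by rewrite trmx_mul trmxK /M !mulmxA.
by rewrite sqE sumr_ge0 // => i _; apply: sqr_ge0.
Qed.

Lemma singular_values_sorted A : sorted >=%R (singular_values A).
Proof. by apply: sort_sorted => x y; apply: le_total. Qed.

Lemma singular_values_ge0 A s : s \in singular_values A -> 0 <= s.
Proof. by rewrite mem_sort => /mapP[x _ ->]; apply: sqrtr_ge0. Qed.

Lemma char_poly_gram A :
  char_poly (A^T *m A) = \prod_(s <- singular_values A) ('X - (s ^+ 2)%:P).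
Proof.
rewrite char_poly_sym ?trmx_mul ?trmxK //.
rewrite /singular_values (perm_big _ (permEl (perm_sort _ _))) big_map.
by apply: eq_big_seq => x /gram_eigenvalue_ge0 x0; rewrite sqr_sqrtr.
Qed.

Lemma size_singular_values A : size (singular_values A) = n.
Proof.
have := congr1 (fun p : {poly R} => size p) (char_poly_gram A).
rewrite size_char_poly.
rewrite -(big_map (fun s => s ^+ 2) xpredT (fun x => 'X - x%:P)).
rewrite size_prod_XsubC size_map => -[nE]; exact: esym nE.
Qed.

End SingularValuesTheory.

(* Main.v *)
Require Import Defs.
From mathcomp Require Import all_boot all_order all_algebra.
From mathcomp Require Import reals normedtype.
From mathcomp Require complex.
From mathcomp Require Import ring lra.

Import Order.TTheory GRing.Theory Num.Theory.
Local Open Scope ring_scope.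

(** Put B = A + I/2, C = J - B, r = sqrt n, and write s, t for the largest
    singular values of B and C. For a matrix X let D(X) be the sum of
    (sigma_i(X) - r/2)^2 over i >= 2. Expanding these squares and using that
    the sum of all sigma_i(X)^2 is the squared Frobenius norm of X expresses
    the trace norm of X through s or t, the Frobenius norm and D(X). Since B and
    C have constant diagonal 1/2 and B + C = J, adding the two expressions gives
    the exact formula [defect_identity]

      r (bound - lhs) = 2 sum_ij a_ij (1 - a_ij) + D(B) + D(C)
                        + (s - n/2)^2 + (t - n/2)^2 + (n - r) (s + t - n).

    Every term is nonnegative: for the last one, r <= n, and s + t >= n because
    n s and n t dominate the sums of the entries of B and C, which add up to
    n^2 ([sigma1_complement_ge]). This proves the inequality.

    Equality means that all the terms vanish. Then A is a (0,1)-matrix, the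
    sigma_i(B) with i >= 2 are r/2, and s = t = n/2. The last fact forces the
    row sums r_i of B to be n/2: they total n * n/2, whereas the squared
    norm of B 1 is at most s^2 n, so that the sum of (r_i - n/2)^2 is <= 0; the
    same holds for the columns ([sums_of_sigma1_half]).

    Conversely, if all rows and columns of B sum to n/2, then C^T C = B^T B
    ([gram_complement]), so B and C have the same singular values; the
    Frobenius norm then determines s = t = n/2 ([sigma1_half]), and every term
    on the right of the formula is zero.

    The bound of the operator norm by sigma_1, used for the row and column sums,
    follows from diagonalizing B^T B in a unitary basis ([rayleigh_le]). *)

(** * The Rayleigh quotient of a symmetric matrix *)

Section Rayleigh.
Import complex.
Variables (R : rcfType) (n : nat).

(** Unitary diagonalization over the complex closure turns x M x^T into a
    combination of the squared moduli of the coordinates of x, weighted by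
    the eigenvalues, which are real because M is symmetric. *)
Lemma rayleigh_le (M : 'M[R]_n) (lam : R) (x : 'rV[R]_n) :
    M^T = M -> {in eigenvalues M, forall a, a <= lam} ->
  (x *m M *m x^T) 0 0 <= lam * (x *m x^T) 0 0.
Proof.
move=> symM ub; pose f : {rmorphism R -> complex R} := real_complex R.
pose Mc := map_mx f M.
have fconj a : Num.conj (f a) = f a by apply/CrealP/complex_realP; exists a.
have hM : Mc \is hermsymmx.
  apply/is_hermitianmxP; rewrite expr0 scale1r; apply/matrixP => i j.
  by rewrite !mxE -[in LHS]symM mxE fconj.
have /hermitian_normalmx/orthomx_spectralP := hM.
have /mxOverP dR := hermitian_spectral_diag_real hM.
have := spectral_unitarymx Mc.
move: (spectralmx Mc) (spectral_diag Mc) dR => P D dR Pu McE.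
have PP : P *m map_mx Num.conj P^T = 1%:M by apply/unitarymxP.
have PP' : map_mx Num.conj P^T *m P = 1%:M by apply: mulmx1C.
rewrite invmx_unitary // in McE.
(* Row i of P is an eigenvector of M for the value D 0 i. *)
have Dle i : D 0 i <= f lam.
  have DE := RRe_real (dR 0 i).
  rewrite -DE lecR; apply: ub; rewrite -root_prod_XsubC -char_poly_sym //.
  rewrite -(fmorph_root f) map_char_poly -eigenvalue_root_char.
  apply/eigenvalueP; exists (row i P).
    rewrite -/Mc -row_mul McE !mulmxA PP mul1mx.
    apply/rowP => j; rewrite mul_diag_mx !mxE.
    by congr (_ * _); rewrite -[LHS]DE.
  apply/eqP => Pi0; have /matrixP/(_ i i) := PP.
  rewrite !mxE eqxx => /eqP; rewrite big1 ?(eq_sym 0) ?oner_eq0 // => j _.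
  by move/rowP/(_ j): Pi0; rewrite !mxE => ->; rewrite mul0r.
(* y is the vector of coordinates of x in the eigenbasis. *)
pose y := map_mx f x *m map_mx Num.conj P^T.
have xT : map_mx f x^T = map_mx Num.conj P^T *m map_mx Num.conj y^T.
  rewrite /y trmx_mul map_mxM map_trmx trmxK -map_mx_comp mulmxA.
  rewrite (_ : map_mx _ P = P); last by apply/matrixP => i j; rewrite !mxE /= conjCK.
  by rewrite PP' mul1mx; apply/matrixP => i j; rewrite !mxE; exact/esym/fconj.
have eE (B : 'M[R]_1) : f (B 0 0) = (map_mx f B) 0 0 by rewrite mxE.
have yy : f ((x *m x^T) 0 0) = \sum_i `|y 0 i| ^+ 2.
  rewrite eE map_mxM xT mulmxA -/y mxE; apply: eq_bigr => i _.
  by rewrite !mxE normCK.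
have yDy : f ((x *m M *m x^T) 0 0) = \sum_i D 0 i * `|y 0 i| ^+ 2.
  rewrite eE !map_mxM -/Mc McE xT !mulmxA -/y -2!mulmxA.
  rewrite [P *m _]mulmxA PP mul1mx mxE; apply: eq_bigr => i _.
  by rewrite mul_mx_diag !mxE normCK mulrCA !mulrA.
rewrite -lecR -/(f _) yDy rmorphM /= -/(f _) yy mulr_sumr.
by apply: ler_sum => i _; rewrite ler_wpM2r ?exprn_ge0.
Qed.
End Rayleigh.

(** * The largest singular value as an operator norm *)

Section SingularValues.
Variables (R : rcfType) (n : nat).
Implicit Types (B : 'M[R]_n) (x y : 'rV[R]_n).

Lemma sum_sqr_ge0 (I : Type) (l : seq I) (F : I -> R) :
  0 <= \sum_(i <- l) F i ^+ 2.
Proof. by apply: sumr_ge0 => i _; apply: sqr_ge0. Qed.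

Lemma dot_self m (x : 'rV[R]_m) : (x *m x^T) 0 0 = \sum_i x 0 i ^+ 2.
Proof. by rewrite mxE; apply: eq_bigr => i _; rewrite mxE expr2. Qed.

Lemma singular_values_le_sigma1 B s :
  s \in singular_values B -> s <= sigma 1 B.
Proof.
rewrite /sigma /=; have := singular_values_sorted B.
case: (singular_values B) => // a l /= pl.
rewrite inE => /predU1P[-> // | sl].
have : all (>=%R a) l by apply: (order_path_min _ pl) => u v w; apply: ge_trans.
by move/allP/(_ s sl).
Qed.

Lemma sigma1_ge0 B : 0 <= sigma 1 B.
Proof.
rewrite /sigma /=; have := @singular_values_ge0 R n B.
by case: (singular_values B) => //= a l; apply; rewrite mem_head.
Qed.

Lemma mulmx_trmx_le_sigma1 B x :
  \sum_i (x *m B^T) 0 i ^+ 2 <= sigma 1 B ^+ 2 * \sum_i x 0 i ^+ 2.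
Proof.
rewrite -!dot_self trmx_mul trmxK mulmxA -[x *m B^T *m B]mulmxA.
apply: rayleigh_le; first by rewrite trmx_mul trmxK.
move=> a aB; rewrite -[a]sqr_sqrtr; last exact: gram_eigenvalue_ge0 aB.
rewrite ler_pXn2r ?nnegrE ?sqrtr_ge0 ?sigma1_ge0 //.
by apply: singular_values_le_sigma1; rewrite mem_sort map_f.
Qed.

(** The bound passes to the transpose by duality: with s = sigma_1(B) and
    z = y B B^T, [mulmx_trmx_le_sigma1] gives |z|^2 <= s^2 |y B|^2, and since
    z . y = |y B|^2, expanding 0 <= |s^2 y - z|^2 leaves
    s^2 (s^2 |y|^2 - |y B|^2) >= 0. *)
Lemma mulmx_le_sigma1 B y : 0 < sigma 1 B ->
  \sum_i (y *m B) 0 i ^+ 2 <= sigma 1 B ^+ 2 * \sum_i y 0 i ^+ 2.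
Proof.
move=> s_gt0; set s := sigma 1 B in s_gt0 *.
have := mulmx_trmx_le_sigma1 B (y *m B); rewrite -/s.
set z := y *m B *m B^T.
have zy : \sum_i z 0 i * y 0 i = \sum_i (y *m B) 0 i ^+ 2.
  rewrite -dot_self trmx_mul mulmxA mxE.
  by apply: eq_bigr => i _; rewrite !mxE.
have := sum_sqr_ge0 _ (index_enum 'I_n) (fun i => s ^+ 2 * y 0 i - z 0 i).
under eq_bigr do rewrite sqrrB exprMn.
rewrite big_split /= sumrB -mulr_sumr sumrMnl.
under [X in _ - X *+ 2]eq_bigr do rewrite -mulrA [y 0 _ * _]mulrC.
rewrite -mulr_sumr zy.
set a := \sum_i y 0 i ^+ 2; set b := \sum_i z 0 i ^+ 2.
set c := \sum_i (y *m B) 0 i ^+ 2 => ab bc.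
have : 0 <= s ^+ 2 * (s ^+ 2 * a - c) by lra.
by rewrite pmulr_rge0 ?exprn_gt0 // subr_ge0.
Qed.

Lemma sum_ones : \sum_(i < n) (const_mx 1 : 'rV[R]_n) 0 i ^+ 2 = n%:R.
Proof.
by under eq_bigr do rewrite mxE expr1n; rewrite sumr_const card_ord.
Qed.

Lemma row_sums_le_sigma1 B :
  \sum_i (\sum_j B i j) ^+ 2 <= sigma 1 B ^+ 2 * n%:R.
Proof.
rewrite -sum_ones; apply: le_trans (mulmx_trmx_le_sigma1 B _).
rewrite le_eqVlt; apply/orP; left; apply/eqP; apply: eq_bigr => i _.
by rewrite mxE; congr (_ ^+ 2); apply: eq_bigr => j _; rewrite !mxE mul1r.
Qed.

Lemma col_sums_le_sigma1 B : 0 < sigma 1 B ->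
  \sum_j (\sum_i B i j) ^+ 2 <= sigma 1 B ^+ 2 * n%:R.
Proof.
move=> s_gt0; rewrite -sum_ones; apply: le_trans (mulmx_le_sigma1 B _ s_gt0).
rewrite le_eqVlt; apply/orP; left; apply/eqP; apply: eq_bigr => i _.
by rewrite mxE; congr (_ ^+ 2); apply: eq_bigr => j _; rewrite !mxE mul1r.
Qed.

Lemma sum_sqr_sub_const (F : 'I_n -> R) (c : R) :
  \sum_i (F i - c) ^+ 2 = \sum_i F i ^+ 2 - 2 * c * \sum_i F i + n%:R * c ^+ 2.
Proof.
have -> : n%:R * c ^+ 2 = \sum_(i < n) c ^+ 2 by rewrite sumr_const card_ord mulr_natl.
rewrite mulr_sumr -sumrB -big_split.
by apply: eq_bigr => i _ /=; ring.
Qed.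

(** The variance of the row sums is nonnegative, so the square of their total
    is at most n times the squared norm of B 1, hence at most (n s)^2. *)
Lemma sum_entries_le_sigma1 B : (0 < n)%N ->
  \sum_i \sum_j B i j <= n%:R * sigma 1 B.
Proof.
move=> n_gt0; have n0 : (0 : R) < n%:R by rewrite ltr0n.
have := sum_sqr_ge0 _ (index_enum 'I_n)
  (fun i => \sum_j B i j - (\sum_i \sum_j B i j) / n%:R).
rewrite sum_sqr_sub_const; have := row_sums_le_sigma1 B.
set q := \sum_i (_ ^+ 2); set t := \sum_i \sum_j B i j => qs.
rewrite (_ : _ + _ = q - t ^+ 2 / n%:R); last by field; rewrite gt_eqF.
rewrite subr_ge0 ler_pdivrMr // => tq.
rewrite leNgt; apply/negP => lt_t.
have s0 := sigma1_ge0 B.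
have : (n%:R * sigma 1 B) ^+ 2 < t ^+ 2.
  by rewrite ltr_pXn2r ?nnegrE ?mulr_ge0 ?(ltW n0) // (le_trans _ (ltW lt_t)) ?mulr_ge0 ?(ltW n0).
rewrite ltNge (le_trans tq) // exprMn mulrC expr2 -mulrA.
by rewrite ler_wpM2l ?(ltW n0) // mulrC.
Qed.

(** * The other singular values *)

(** Both sides are the trace of B^T B, read off its characteristic polynomial. *)
Lemma sum_singular_values_sqr B :
  \sum_(s <- singular_values B) s ^+ 2 = \sum_i \sum_j B i j ^+ 2.
Proof.
have [n0|n_gt0] := posnP n.
  rewrite (size0nil (etrans (size_singular_values B) n0)) big_nil.
  by rewrite big1 // => i; have := ltn_ord i; rewrite {2}n0.
transitivity (\tr (B^T *m B)); last first.
  rewrite exchange_big; apply: eq_bigr => i _; rewrite mxE.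
  by apply: eq_bigr => j _; rewrite mxE expr2.
apply: oppr_inj; rewrite -char_poly_trace // char_poly_gram.
rewrite -(big_map (fun s => s ^+ 2) xpredT id).
rewrite -(big_map (fun s => s ^+ 2) xpredT (fun a => 'X - a%:P)).
have szE : size [seq s ^+ 2 | s <- singular_values B] = n.
  by rewrite size_map size_singular_values.
by rewrite -coefPn_prod_XsubC ?szE -?lt0n.
Qed.

Definition tail_spread B r : R :=
  \sum_(s <- behead (singular_values B)) (s - r) ^+ 2.

Lemma tail_spread_eq0_mem B r s :
  tail_spread B r = 0 -> s \in behead (singular_values B) -> s = r.
Proof.
move=> D0 sB; apply/eqP; rewrite -subr_eq0 -sqrf_eq0; move/eqP: D0.
by rewrite psumr_eq0 => [/allP/(_ s sB)|x _]; last exact: sqr_ge0.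
Qed.

Lemma tail_spread_eq0 B r :
  tail_spread B r = 0 <-> forall i, (2 <= i <= n)%N -> sigma i B = r.
Proof.
split=> [D0 [|[|i]] // i_le | sE].
  apply: (tail_spread_eq0_mem B _ _ D0).
  rewrite /sigma /= -nth_behead mem_nth // size_behead size_singular_values.
  by case: n i_le.
rewrite /tail_spread big1_seq // => s /= /(nthP 0)[i].
rewrite size_behead size_singular_values => i_lt <-.
rewrite nth_behead -[_`_i.+1]/(sigma i.+2 B) sE ?subrr ?expr0n //.
by case: n i_lt.
Qed.

(** Termwise, 2 r s = s^2 + r^2 - (s - r)^2, applied to all the singular values
    but the first. *)
Lemma trace_norm_tail_spread B r : (0 < n)%N ->
  2 * r * trace_norm B = 2 * r * sigma 1 B + \sum_i \sum_j B i j ^+ 2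
    - sigma 1 B ^+ 2 + (n%:R - 1) * r ^+ 2 - tail_spread B r.
Proof.
move=> n_gt0; rewrite -sum_singular_values_sqr /trace_norm /sigma /tail_spread.
have := size_singular_values B.
case: (singular_values B) => [|a l] /= sz; first by rewrite -sz in n_gt0.
have -> : n%:R - 1 = (size l)%:R :> R by rewrite -sz -natr1 addrK.
rewrite !big_cons.
have -> : \sum_(s <- l) (s - r) ^+ 2 =
    \sum_(s <- l) s ^+ 2 - 2 * r * \sum_(s <- l) s + (size l)%:R * r ^+ 2.
  elim: l {sz} => [|b l IH]; first by rewrite !big_nil /=; ring.
  by rewrite !big_cons IH /= -natr1; ring.
ring.
Qed.

Lemma sum_sqr_of_tail_const B r : (0 < n)%N -> tail_spread B r = 0 ->
  \sum_i \sum_j B i j ^+ 2 = sigma 1 B ^+ 2 + (n%:R - 1) * r ^+ 2.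
Proof.
move=> n_gt0 D0; rewrite -sum_singular_values_sqr /sigma.
have := size_singular_values B; have := tail_spread_eq0_mem B r.
case: (singular_values B) => [|a l] /= lr sz; first by rewrite -sz in n_gt0.
have -> : n%:R - 1 = (size l)%:R :> R by rewrite -sz -natr1 addrK.
rewrite big_cons (eq_big_seq (fun=> r ^+ 2)) => [|s /lr-> //].
by rewrite big_const_seq count_predT iter_addr_0 mulr_natl //.
Qed.

End SingularValues.
Arguments tail_spread {R n} B r.

(** * A matrix and its complement *)

Section Complement.
Variables (R : rcfType) (n : nat).
Implicit Types (A B : 'M[R]_n).

(** Equality case of the Cauchy-Schwarz inequality against the all-ones
    vector. *)
Lemma eq_const_of_sum_sqr_le (F : 'I_n -> R) c :
    \sum_i F i = n%:R * c -> \sum_i F i ^+ 2 <= c ^+ 2 * n%:R ->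
  forall i, F i = c.
Proof.
move=> Fs Fq i; apply/eqP; rewrite -subr_eq0 -sqrf_eq0; apply/eqP.
apply: (psumr_eq0P (P := xpredT) (F := fun i => (F i - c) ^+ 2)) => //.
  by move=> j _; apply: sqr_ge0.
apply/le_anti; rewrite sum_sqr_ge0 andbT sum_sqr_sub_const Fs.
set q := \sum_i _ in Fq *; nra.
Qed.

(** In (J - B)^T (J - B) the four terms are J^2 = n J, the two cross terms
    - c J and B^T B; the first three cancel when 2 c = n. *)
Lemma gram_complement B c : 2 * c = n%:R ->
    (forall i, \sum_j B i j = c) -> (forall j, \sum_i B i j = c) ->
  (const_mx 1 - B)^T *m (const_mx 1 - B) = B^T *m B.
Proof.
move=> cn Br Bc; apply/matrixP => i j; rewrite !mxE.
have -> : \sum_k (const_mx 1 - B)^T i k * (const_mx 1 - B) k j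
    = \sum_k (1 - B k i - B k j + B^T i k * B k j).
  by apply: eq_bigr => k _; rewrite !mxE; ring.
rewrite big_split /= !sumrB !Bc sumr_const card_ord -cn; ring.
Qed.

(** If b + c = 1 then b^2 + c^2 = 1 - 2 b (1 - b); the n diagonal entries b = 1/2
    account for the term n/2. *)
Lemma sum_sqr_shifted A : (forall i, A i i = 0) ->
  \sum_i \sum_j (A + (1 / 2) *: 1%:M) i j ^+ 2
   + \sum_i \sum_j (const_mx 1 - A - (1 / 2) *: 1%:M) i j ^+ 2
  = n%:R ^+ 2 - n%:R / 2 - 2 * \sum_i \sum_j A i j * (1 - A i j).
Proof.
move=> A0; rewrite -big_split mulr_sumr.
have -> : n%:R ^+ 2 - n%:R / 2 = \sum_(i < n) (n%:R - 2^-1) :> R.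
  by rewrite sumr_const card_ord -mulr_natl; ring.
rewrite -sumrB; apply: eq_bigr => i _ /=.
rewrite -big_split mulr_sumr /=.
have -> : n%:R - 2^-1 = \sum_(j < n) (1 - 2^-1 * (i == j)%:R) :> R.
  rewrite sumrB sumr_const card_ord -mulr_sumr; congr (_ - _).
  by rewrite (bigD1 i) //= eqxx big1 ?addr0 ?mulr1 // => j /negPf; rewrite eq_sym => ->.
rewrite -sumrB; apply: eq_bigr => j _; rewrite !mxE.
have [->|_] := eqVneq i j; rewrite ?A0 /=; lra.
Qed.

(** The comparison value r/2 for the singular values with i >= 2 is their common
    value in the extremal case; the bracket left after adding the two trace
    norms, s^2 + t^2 - n^2/2 - r (s + t - n), is then rewritten as
    (s - n/2)^2 + (t - n/2)^2 + (n - r) (s + t - n). *)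
Lemma defect_identity A : (0 < n)%N -> (forall i, A i i = 0) ->
  let B := A + (1 / 2) *: 1%:M in
  let C := const_mx 1 - A - (1 / 2) *: 1%:M in
  let r := Num.sqrt n%:R in
  r * (n%:R + (n%:R - 1) * r - (trace_norm B + trace_norm C)) =
    2 * (\sum_i \sum_j A i j * (1 - A i j))
    + (tail_spread B (r / 2) + tail_spread C (r / 2))
    + ((sigma 1 B - n%:R / 2) ^+ 2 + (sigma 1 C - n%:R / 2) ^+ 2)
    + (n%:R - r) * (sigma 1 B + sigma 1 C - n%:R).
Proof.
move=> n_gt0 A0 B C r.
have r2 : r ^+ 2 = n%:R by rewrite sqr_sqrtr.
have rr : 2 * (r / 2) = r by rewrite mulrC divfK ?pnatr_eq0.
have rn : (r / 2) ^+ 2 = n%:R / 4 by rewrite -r2; field.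
have := trace_norm_tail_spread _ _ B (r / 2) n_gt0.
have := trace_norm_tail_spread _ _ C (r / 2) n_gt0.
have := sum_sqr_shifted A A0; rewrite -/B -/C rr rn.
set FB := (\sum_i _); set FC := (\sum_i _); set E := (\sum_i _) => FE TC TB.
rewrite mulrBr mulrDr mulrDr TB TC [r * (_ * r)]mulrCA -expr2 r2.
have -> : FB = n%:R ^+ 2 - n%:R / 2 - 2 * E - FC by rewrite -FE addrK.
move: (sigma 1 B) (sigma 1 C) (tail_spread B _) (tail_spread C _) => *.
by field.
Qed.

End Complement.

(** * Signs of the terms and the equality case *)

Section Equality.
Variables (R : rcfType) (n : nat).
Implicit Types (A B : 'M[R]_n).

Lemma sum_row_shifted A c i :
  \sum_j (A + c *: 1%:M) i j = \sum_j A i j + c.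
Proof.
under eq_bigr do rewrite !mxE.
rewrite big_split -mulr_sumr; congr (_ + _).
rewrite (bigD1 i) //= eqxx big1 ?addr0 ?mulr1 // => j /negPf.
by rewrite eq_sym => ->.
Qed.

Lemma sum_col_shifted A c j :
  \sum_i (A + c *: 1%:M) i j = \sum_i A i j + c.
Proof.
transitivity (\sum_i (A^T + c *: 1%:M) j i).
  by apply: eq_bigr => i _; rewrite !mxE eq_sym.
by rewrite sum_row_shifted; congr (_ + _); apply: eq_bigr => i _; rewrite mxE.
Qed.

Lemma sum_entries_complement B :
  \sum_i \sum_j B i j + \sum_i \sum_j (const_mx 1 - B) i j = n%:R ^+ 2.
Proof.
have -> : n%:R ^+ 2 = \sum_(i < n) \sum_(j < n) (1 : R).
  by rewrite !sumr_const !card_ord -mulrnA expr2 natrM.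
rewrite -big_split; apply: eq_bigr => i _; rewrite -big_split.
by apply: eq_bigr => j _; rewrite !mxE /= addrC subrK.
Qed.

Lemma sigma1_complement_ge B : (0 < n)%N ->
  n%:R <= sigma 1 B + sigma 1 (const_mx 1 - B).
Proof.
move=> n_gt0; have n0 : (0 : R) < n%:R by rewrite ltr0n.
rewrite -(ler_pM2l n0) -expr2 -(sum_entries_complement B) mulrDr.
by rewrite lerD // sum_entries_le_sigma1.
Qed.

(** The totals of B and of J - B are at most n^2/2 each and add up to n^2, so
    the total of B is n^2/2, and the row and column sums have the least sum of
    squares that this total allows. *)
Lemma sums_of_sigma1_half B : (0 < n)%N ->
    sigma 1 B = n%:R / 2 -> sigma 1 (const_mx 1 - B) = n%:R / 2 ->
  (forall i, \sum_j B i j = n%:R / 2) /\ (forall j, \sum_i B i j = n%:R / 2).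
Proof.
move=> n_gt0 sB sC; have n0 : (0 : R) < n%:R by rewrite ltr0n.
have total : \sum_i \sum_j B i j = n%:R * (n%:R / 2).
  have := sum_entries_le_sigma1 _ _ B n_gt0.
  have := sum_entries_le_sigma1 _ _ (const_mx 1 - B) n_gt0.
  have := sum_entries_complement B; rewrite sB sC; lra.
split; apply: eq_const_of_sum_sqr_le.
- exact: total.
- by rewrite -sB row_sums_le_sigma1.
- by rewrite exchange_big.
- by rewrite -sB col_sums_le_sigma1 // sB divr_gt0.
Qed.

Lemma sum_mul_compl_eq0 A : (forall i j, 0 <= A i j * (1 - A i j)) ->
  \sum_i \sum_j A i j * (1 - A i j) = 0 <->
  forall i j, A i j = 0 \/ A i j = 1.
Proof.
move=> A_ge0; split=> [E0 i j | A01].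
  have Ei : \sum_j A i j * (1 - A i j) = 0.
    by apply: (psumr_eq0P _ E0) => // k _; apply: sumr_ge0.
  have /eqP : A i j * (1 - A i j) = 0 by apply: (psumr_eq0P _ Ei).
  by rewrite mulf_eq0 subr_eq0 => /orP[/eqP|/eqP/esym]; [left|right].
rewrite big1 // => i _; rewrite big1 // => j _.
by case: (A01 i j) => ->; rewrite ?subr0 ?subrr ?mulr0 ?mul0r.
Qed.

(** When the singular values of B and C agree, each of the two matrices carries
    half of the squared Frobenius mass n^2 - n/2; removing (n - 1) (r/2)^2
    leaves sigma_1^2 = n^2/4. *)
Lemma sigma1_half A r : (0 < n)%N -> (forall i, A i i = 0) ->
    \sum_i \sum_j A i j * (1 - A i j) = 0 -> r ^+ 2 = n%:R ->
  let B := A + (1 / 2) *: 1%:M in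
  let C := const_mx 1 - A - (1 / 2) *: 1%:M in
  singular_values C = singular_values B -> tail_spread B (r / 2) = 0 ->
  sigma 1 B = n%:R / 2.
Proof.
move=> n_gt0 A0 E0 r2 B C svC DB0.
have DC0 : tail_spread C (r / 2) = 0 by rewrite /tail_spread svC.
have := sum_sqr_shifted _ _ A A0; rewrite -/B -/C E0.
rewrite (sum_sqr_of_tail_const _ _ _ _ n_gt0 DB0).
rewrite (sum_sqr_of_tail_const _ _ _ _ n_gt0 DC0).
rewrite [sigma 1 C]/sigma svC -/(sigma 1 B) expr_div_n r2.
have := sigma1_ge0 _ _ B; move: (sigma 1 B) => s s_ge0 FE.
apply/eqP; rewrite -(eqrXn2 (n := 2)) ?divr_ge0 ?ler0n //.
by apply/eqP; move: FE; clear=> FE; lra.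
Qed.

End Equality.

Lemma nonneg_sum_eq0 (R : realFieldType) (e a b c d k : R) :
    0 <= e -> 0 <= a -> 0 <= b -> 0 <= c -> 0 <= d -> 0 <= k ->
  0 <= 2 * e + (a + b) + (c + d) + k
  /\ (2 * e + (a + b) + (c + d) + k = 0 -> [/\ e = 0, a = 0, c = 0 & d = 0]).
Proof. by move=> *; split=> [|?]; [lra | split; lra]. Qed.

Theorem theorem3 (R : realType) (n : nat) (A : 'M[R]_n)
    (A_ge0 : forall i j : 'I_n, 0 <= A i j)
    (A_le1 : mx_norm A <= 1)
    (A_diag : forall i : 'I_n, A i i = 0) :
  let lhs := trace_norm (A + (1 / 2) *: 1%:M)
             + trace_norm (const_mx 1 - A - (1 / 2) *: 1%:M) in
  let bound : R := n%:R + (n%:R - 1) * Num.sqrt n%:R in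
  lhs <= bound /\
  (lhs = bound <->
     [/\ forall i j : 'I_n, A i j = 0 \/ A i j = 1,
         forall i : 'I_n, \sum_(j < n) A i j = (n%:R - 1) / 2,
         forall j : 'I_n, \sum_(i < n) A i j = (n%:R - 1) / 2
       & forall i : nat, (2 <= i <= n)%N ->
           sigma i (A + (1 / 2) *: 1%:M) = Num.sqrt n%:R / 2]).
Proof.
have [n0|n_gt0] := posnP n.
  (* For n = 0 there are no singular values, and the bound is 0. *)
  have sv0 (X : 'M[R]_n) : trace_norm X = 0.
    rewrite /trace_norm.
    by rewrite (size0nil (etrans (size_singular_values X) n0)) big_nil.
  have void (i : 'I_n) : False by have := ltn_ord i; rewrite {2}n0.
  move=> lhs bound; have -> : lhs = bound.
    by rewrite /lhs /bound !sv0 n0 sqrtr0 mulr0 addr0.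
  split; first exact: lexx.
  split=> _; last by [].
  split=> [i|i|i|i]; try by case: (void i).
  by move=> /andP[i_gt1 /(leq_trans i_gt1)]; rewrite [X in (_ < X)%N]n0.
have prod_ge0 i j : 0 <= A i j * (1 - A i j).
  rewrite mulr_ge0 // subr_ge0; apply: le_trans A_le1.
  apply: le_trans (ler_norm _) _; rewrite mx_normrE.
  exact: (le_bigmax _ (fun ij : 'I_n * 'I_n => `|A ij.1 ij.2|) (i, j)).
move=> lhs bound; set r := Num.sqrt n%:R.
have n0 : (0 : R) < n%:R by rewrite ltr0n.
have r_gt0 : 0 < r by rewrite sqrtr_gt0.
have r2 : r ^+ 2 = n%:R by rewrite sqr_sqrtr ?ler0n.
have := defect_identity _ _ A n_gt0 A_diag.
rewrite /= -/r -/lhs -/bound.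
set B := A + _ *: _; set C := const_mx 1 - A - _ *: _.
have CE : C = const_mx 1 - B by rewrite /C /B opprD addrA.
have r_le : 0 <= n%:R - r.
  have n1 : (1 : R) <= n%:R by rewrite ler1n.
  rewrite subr_ge0; nra.
have st_ge : 0 <= sigma 1 B + sigma 1 C - n%:R.
  by rewrite subr_ge0 CE sigma1_complement_ge.
have E_ge0 : 0 <= \sum_i \sum_j A i j * (1 - A i j).
  by apply: sumr_ge0 => i _; apply: sumr_ge0.
have DB_ge0 : 0 <= tail_spread B (r / 2) by apply: sum_sqr_ge0.
have DC_ge0 : 0 <= tail_spread C (r / 2) by apply: sum_sqr_ge0.
have sB_ge0 := sqr_ge0 (sigma 1 B - n%:R / 2).
have sC_ge0 := sqr_ge0 (sigma 1 C - n%:R / 2).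
have K_ge0 := mulr_ge0 r_le st_ge.
have [total_ge0 total_eq0] :=
  nonneg_sum_eq0 _ _ _ _ _ _ _ E_ge0 DB_ge0 DC_ge0 sB_ge0 sC_ge0 K_ge0.
move=> defect; split.
  by rewrite -subr_ge0 -(pmulr_rge0 _ r_gt0) defect.
split=> [lhsE|[A01 Arow Acol tailB]].
  move: defect; rewrite lhsE subrr mulr0 => /esym/total_eq0[E0 DB0 sB0 sC0].
  have sB : sigma 1 B = n%:R / 2.
    by apply/eqP; rewrite -subr_eq0 -sqrf_eq0 sB0.
  have sC : sigma 1 C = n%:R / 2.
    by apply/eqP; rewrite -subr_eq0 -sqrf_eq0 sC0.
  rewrite CE in sC; have [Brow Bcol] := sums_of_sigma1_half _ _ B n_gt0 sB sC.
  split; last exact/tail_spread_eq0.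
  - exact/(sum_mul_compl_eq0 _ _ _ prod_ge0).
  - move=> i; by apply: (addIr (1 / 2)); rewrite -sum_row_shifted Brow; field.
  - move=> j; by apply: (addIr (1 / 2)); rewrite -sum_col_shifted Bcol; field.
have Brow i : \sum_j B i j = n%:R / 2 by rewrite sum_row_shifted Arow; field.
have Bcol j : \sum_i B i j = n%:R / 2 by rewrite sum_col_shifted Acol; field.
have svC : singular_values C = singular_values B.
  rewrite /singular_values CE (@gram_complement _ _ B (n%:R / 2)) //.
  by rewrite mulrC divfK ?pnatr_eq0.
have DB0 : tail_spread B (r / 2) = 0 by apply/tail_spread_eq0.
have E0 : \sum_i \sum_j A i j * (1 - A i j) = 0.
  exact/(sum_mul_compl_eq0 _ _ _ prod_ge0).
have sCB : sigma 1 C = sigma 1 B by rewrite /sigma svC.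
have DC0 : tail_spread C (r / 2) = 0 by rewrite /tail_spread svC.
have sB : sigma 1 B = n%:R / 2 by apply: sigma1_half r2 svC DB0.
move: defect; rewrite E0 DB0 DC0 sCB sB => /eqP.
rewrite (_ : n%:R / 2 + n%:R / 2 - n%:R = 0); last by field.
rewrite subrr expr0n !mulr0 !addr0 mulf_eq0 (gt_eqF r_gt0) subr_eq0.
by move=> /eqP.
Qed.
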